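(* Let $N,d\ge 1$ be integers, let $T>0$ be finite, let $m,\delta,h>0$, let $M$ be a positive normalizing factor $M=M(N,i,\#\mathcal N_i)>0$, and let $(\mathbf x_0,\mathbf v_0)=(x_{10},\dots,x_{N0},v_{10},\dots,v_{N0})\in\mathbb R^{2dN}$ be initial data. Then the density-induced consensus system $$\dot x_i=v_i,\quad x_i(0)=x_{i0},\qquad \dot v_i=\sum_{k\in\mathcal N_i(t)}M\,(v_k-v_i),\quad v_i(0)=v_{i0},\qquad i=1,\dots,N,$$ with neighbor sets $\mathcal N_i(t)$ defined in the context, admits a unique solution in $W^{1,\infty}([0,T))$, and its velocity fluctuation is nonincreasing: setting $$V(t):=\max_{i,j\in\{1,\dots,N\}}|v_i(t)-v_j(t)|,$$ one has $$V(t)\le V(s)\le V(0)\qquad\text{for all } 0<s\le t<T .$$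
   Context: Unknowns: $(x_i(t),v_i(t))\in\mathbb R^{2d}$ for $i=1,\dots,N$ (position and velocity of the $i$th particle); $|\cdot|$ is the Euclidean norm, $B(x,\rho)$ is the open ball in $\mathbb R^d$ with center $x$ and radius $\rho$, and $\#$ denotes cardinality. Neighbor sets: for $t\ge h$, $$k\in\mathcal N_i(t)\iff x_k(t-h)\in B(x_i(t-h),\delta)\ \text{ and }\ \#\{l\in\{1,\dots,N\}: x_l(t-h)\in B(x_i(t-h),\delta)\}>m .$$ For $t\in[0,h)$ the same definition is used with $x_\cdot(t-h)$ replaced by $x_\cdot(0)$. In particular $\mathcal N_i(t)=\emptyset$ if the number of particles (including $i$ itself) in the ball is not larger than $m$; then the sum in the equation for $v_i$ is zero. Normalizing factor: $M=M(N,i,\#\mathcal N_i)$ is any positive function of $N$, of the index $i$, and of $\#\mathcal N_i(t)$ (e.g. $M=\kappa/N$ or $M=\kappa/\#\mathcal N_i$ with $\kappa>0$). A solution in $W^{1,\infty}([0,T))$ means Lipschitz continuous functions $x_i,v_i:[0,T)\to\mathbb R^d$ satisfying the initial conditions and satisfying the differential equations for almost every $t\in[0,T)$ (the right-hand side may be discontinuous in time because the sets $\mathcal N_i(t)$ change). *)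

(* Defs.v *)
From mathcomp Require Import all_boot all_order all_algebra.
From mathcomp Require Import all_classical all_reals all_analysis.
Set Implicit Arguments.
Unset Strict Implicit.
Unset Printing Implicit Defensive.
Import Order.TTheory GRing.Theory Num.Theory.
Import numFieldNormedType.Exports.
Local Open Scope ring_scope.

(* The library norm on row vectors is the sup norm, so the Euclidean norm is
   introduced separately. *)
Definition enorm (R : realType) (d : nat) (u : 'rV[R]_d) : R :=
  Num.sqrt (\sum_(k < d) u 0 k ^+ 2).

Definition eball (R : realType) (d : nat) (a : 'rV[R]_d) (r : R) :
  pred 'rV[R]_d := [pred y | enorm (y - a) < r].

(* On [0, h) the neighbors are those of the configuration at time 0. *)
Definition delayed (R : realType) (h t : R) : R := if t < h then 0 else t - h.

Definition neighbors (R : realType) (N d : nat) (m delta h : R)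
    (x : 'I_N -> R -> 'rV[R]_d) (i : 'I_N) (t : R) : {set 'I_N} :=
  let s := delayed h t in
  [set k | (x k s \in eball (x i s) delta) &&
           (m < #|[set l | x l s \in eball (x i s) delta]|%:R)].

(* Trajectories are total functions of time, of which only the restriction to
   [0, T) is relevant.  N being fixed, the normalizing factor is a function of
   the index i and of the number of neighbors.  Lipschitz continuity does not
   depend on the choice between the sup norm and the Euclidean norm; neither
   does differentiability. *)
Record is_solution (R : realType) (N d : nat) (T m delta h : R)
    (M : 'I_N -> nat -> R) (x0 v0 : 'I_N -> 'rV[R]_d)
    (x v : 'I_N -> R -> 'rV[R]_d) : Prop := IsSolution {
  sol_lipschitz_x : forall i, [lipschitz x i t | t in `[0, T[%classic] ;
  sol_lipschitz_v : forall i, [lipschitz v i t | t in `[0, T[%classic] ;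
  sol_init_x : forall i, x i 0 = x0 i ;
  sol_init_v : forall i, v i 0 = v0 i ;
  sol_eq_x : forall i, {ae lebesgue_measure, forall t : R,
    t \in `[0, T[ -> is_derive t 1 (x i) (v i t)} ;
  sol_eq_v : forall i, {ae lebesgue_measure, forall t : R,
    t \in `[0, T[ -> is_derive t 1 (v i)
      (\sum_(k in neighbors m delta h x i t)
         M i #|neighbors m delta h x i t| *: (v k t - v i t))}
}.

(* All terms are nonnegative, so 0 is a neutral base value for the maximum. *)
Definition vel_diam (R : realType) (N d : nat) (v : 'I_N -> R -> 'rV[R]_d)
    (t : R) : R :=
  \big[Num.max/0]_(i < N) \big[Num.max/0]_(j < N) enorm (v i t - v j t).

(* Main.v *)
(* Since the neighbor sets at time t only depend on the positions at time t - h, prescribing the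
   trajectory X that determines them leaves a linear system for the velocities, whose coefficients
   are nonnegative, bounded and measurable in time.  It is solved by Picard iteration, a contraction
   for the sup norm with weight exp(-2Kt).  Iterating X |-> (positions of this linear solution)
   gains exactness on one more interval of length h at each step, so a fixed point on [0, T) is
   reached after finitely many steps.

   Uniqueness and the decay of the velocity diameter both come from a maximum principle: for every
   linear form, the largest component of the projected velocities has nonpositive derivative
   almost everywhere, hence its maximum over the particles is nonincreasing; take as linear form
   the pairing with v_i(t) - v_j(t). *)
Require Import Defs.
From mathcomp Require Import all_boot all_order all_algebra.
From mathcomp Require Import all_classical all_reals all_analysis.
From mathcomp Require Import measurable_realfun.
From mathcomp Require Import ring lra.
Import Order.TTheory GRing.Theory Num.Theory.
Import numFieldNormedType.Exports.
Local Open Scope classical_set_scope.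
Local Open Scope ring_scope.
Set Implicit Arguments.
Unset Strict Implicit.

Lemma klipschitz_continuous (R : realType) (f : R -> R) (L : R) :
  (forall s t, `|f s - f t| <= L * `|s - t|) -> continuous f.
Proof.
move=> fL t; apply/cvgrPdist_lt => e e0.
have L0 : 0 < `|L| + 1 by rewrite ltr_pwDr.
near=> s.
apply: le_lt_trans (fL _ _) _.
apply: (@le_lt_trans _ _ ((`|L| + 1) * `|t - s|)).
  by rewrite ler_wpM2r// ler_wpDr// ler_norm.
rewrite mulrC -ltr_pdivlMr//.
near: s; apply: (@cvgr_dist_lt _ _ _ (nbhs t) _ id) => //.
by rewrite divr_gt0.
Unshelve. all: by end_near. Qed.

(** * Maximum principle for almost everywhere derivatives *)

(** The growth allowed is exactly that of the barrier off [O], so a component with nonpositive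
    derivative stays below the barrier for a short time. *)
Lemma is_derive_le0_near_right (R : realType) (f : R -> R) (t l e : R) :
  is_derive t 1 f l -> l <= 0 -> 0 < e ->
  \forall s \near t^'+, f s <= f t + e * (s - t).
Proof.
move=> fl l0 e0.
have : (fun h => h^-1 *: (f (h *: 1 + t) - f t)) @ 0^' --> l.
  by case: fl => /[swap] <-; exact.
move=> /cvgrPdist_lt/(_ _ e0)[r /= r0 rP].
near=> s.
have st : t < s by near: s; exact: nbhs_right_gt.
have sr : s < t + r by near: s; apply: nbhs_right_lt; rewrite ltrDl.
have s0 : 0 < s - t by rewrite subr_gt0.
have := rP (s - t).
rewrite /= sub0r normrN gtr0_norm// ltrBlDl => /(_ sr).
rewrite gt_eqF// => /(_ isT).
rewrite [_ *: 1]mulr1 subrK ltr_distlC => /andP[_].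
rewrite [_ *: _]mulrC ltr_pdivrMr// => H.
rewrite -lerBlDl; apply: (le_trans (ltW H)); rewrite ler_pM2r//.
by rewrite gerDr.
Unshelve. all: by end_near. Qed.

Section max_principle.
Context {R : realType} (I : finType) (u : I -> R -> R) (a b L : R).
Hypothesis ab : a <= b.
Hypothesis L0 : 0 <= L.
Hypothesis uL : forall i s t, a <= s -> s <= t -> t <= b ->
  `|u i t - u i s| <= L * (t - s).
Local Notation mu := (@lebesgue_measure R).

(* [O] is an open neighborhood of small measure of the exceptional null set.  The barrier grows at
   rate at least [L] inside [O], where nothing is known about derivatives, and at least [e]
   elsewhere, so no component of [u] can cross it. *)
Let barrier (O : set R) (e t : R) : R := L * fine (mu (O `&` `]a, t])) + e * (t - a).

Let fin_itv (O : set R) (s t : R) : open O ->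
  (mu (O `&` `]s, t]) \is a fin_num)%E.
Proof.
move=> oO; rewrite ge0_fin_numE//.
apply: (@le_lt_trans _ _ (mu `]s, t])).
  by apply: le_measure; rewrite ?inE//; apply: measurableI => //; exact: open_measurable.
by rewrite /= lebesgue_measure_itv/=; case: ifP => _; rewrite ?ltry.
Qed.

Let barrier_step (O : set R) (e s t : R) : open O -> a <= s -> s <= t ->
  barrier O e t = barrier O e s + L * fine (mu (O `&` `]s, t])) + e * (t - s).
Proof.
move=> oO as_ st.
have mO (x y : R) : measurable (O `&` `]x, y]).
  by apply: measurableI => //; exact: open_measurable.
rewrite /barrier.
have -> : (O `&` `]a, t] = (O `&` `]a, s]) `|` (O `&` `]s, t]))%classic.
  rewrite -setIUr; congr (_ `&` _).
  by rewrite -itv_bndbnd_setU// bnd_simp.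
rewrite measureU; [|exact: mO|exact: mO|]; last first.
  apply/seteqP; split => // x [[_ /=]]; rewrite in_itv/= => /andP[_ xs] [_ /=].
  by rewrite in_itv/= => /andP[/lt_le_trans/(_ xs)]; rewrite ltxx.
rewrite fineD ?fin_itv//; ring.
Qed.

Let barrier_homo (O : set R) (e s t : R) : open O -> 0 <= e -> a <= s -> s <= t ->
  barrier O e s + e * (t - s) <= barrier O e t.
Proof.
move=> oO e0 as_ st; rewrite (barrier_step _ oO as_ st).
by rewrite lerD2r lerDl mulr_ge0// fine_ge0.
Qed.

Let barrier_open (O : set R) (e s t : R) : open O -> 0 <= e -> a <= s -> s <= t ->
  `]s, t] `<=` O -> barrier O e s + L * (t - s) <= barrier O e t.
Proof.
move=> oO e0 as_ st /setIidr stO; rewrite (barrier_step _ oO as_ st).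
rewrite stO /= lebesgue_measure_itv/= lte_fin.
have [st'|ts] := ltP s t; last first.
  by rewrite (@le_anti _ _ s t) ?st// subrr !mulr0 !addr0.
by rewrite /= lerDl mulr_ge0// subr_ge0.
Qed.

(** A continuation argument: the bound passes to the supremum [m] of the times up to which it holds,
    and if [m < b] it persists on some interval to the right of [m], a contradiction. The hypothesis
    on derivatives only concerns components that are maximal at the given time. *)
Let barrier_dominates (O E : set R) (e c : R) : open O -> E `<=` O -> 0 < e ->
  (forall t, a <= t < b -> ~ E t -> forall i, (forall j, u j t <= u i t) ->
    exists2 l : R, l <= 0 & is_derive t 1 (u i) l) ->
  (forall i, u i a <= c) -> forall i, u i b <= c + barrier O e b.
Proof.
move=> oO EO e0 uE uc.
pose P t := forall i, u i t <= c + barrier O e t.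
pose S := [set t | a <= t <= b /\ forall s, a <= s <= t -> P s]%classic.
have Pa : P a.
  by move=> i; rewrite /barrier set_itvoc0 setI0 measure0 mulr0 subrr mulr0 !addr0.
have Sa : S a.
  by split=> [|s /le_anti <-//]; rewrite lexx.
have S0 : (S !=set0)%classic by exists a.
have ubS : ubound S b by move=> t [/andP[]].
have supS : has_sup S by split=> //; exists b.
set m := sup S.
have am : a <= m by apply: ub_le_sup => //; exists b.
have mb : m <= b by apply: ge_sup.
have Plt s : a <= s -> s < m -> P s.
  move=> as_ /(sup_gt S0)[t [tab tP] st]; apply: tP.
  by rewrite as_ ltW.
have Pm : P m.
  move=> i; have [am'|ma] := ltP a m; last first.
    by rewrite (@le_anti _ _ m a) ?ma.
  apply/ler_addgt0Pl => z z0.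
  (* Close enough to [m] that the Lipschitz bound on [[s, m]] costs at most [z], yet still in [[a,
     m[], where the bound is known. *)
  pose s := Num.max a (m - z / (L + 1)).
  have L1 : 0 < L + 1 by rewrite ltr_wpDl.
  have as_ : a <= s by rewrite le_max lexx.
  have sm : s < m by rewrite gt_max am' ltrBlDr ltrDl divr_gt0.
  have smz : m - z / (L + 1) <= s by rewrite le_max lexx orbT.
  have := uL i as_ (ltW sm) mb.
  rewrite ler_norml => /andP[_].
  have := Plt _ as_ sm i.
  have := barrier_homo oO (ltW e0) as_ (ltW sm).
  have : L * (m - s) <= z.
    apply: (@le_trans _ _ (L * (z / (L + 1)))).
      by rewrite ler_wpM2l// lerBlDr -lerBlDl.
    rewrite mulrA ler_pdivrMr// mulrC ler_pM2l// lerDl//.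
  have : 0 <= e * (m - s) by rewrite mulr_ge0 ?ltW// subr_gt0.
  lra.
have Sm : S m.
  split=> [|s /andP[as_]]; first by rewrite am.
  by rewrite le_eqVlt => /predU1P[->//|]; exact: Plt.
have [mb'|bm] := ltP m b; last by rewrite (@le_anti _ _ b m) ?bm// => i; exact: Pm.
suff : \forall s \near m^'+, P s.
  move=> [r /= r0 rP].
  pose s := Num.min b (m + r / 2).
  have ms : m < s by rewrite lt_min mb' ltrDl divr_gt0.
  have Ss : S s.
    split=> [|t /andP[at_ ts]]; first by rewrite (le_trans am (ltW ms))/= ge_min lexx.
    have [tm|mt] := leP t m; first by apply: Sm.2; rewrite at_.
    apply: rP => //=; rewrite ltr0_norm ?subr_lt0// opprB ltrBlDl.
    apply: (le_lt_trans ts); rewrite gt_min; apply/orP; right.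
    by rewrite ltrD2l ltr_pdivrMr// mulr_natr mulr2n ltrDl.
  have : s <= m by apply: ub_le_sup => //; exists b.
  by rewrite leNgt ms.
(* Three cases: [m] lies in [O]; or it does not and component [i] is maximal; or another component
   is strictly larger. *)
apply: filter_forall => i.
have [Om|nOm] := pselect (O m).
  have [r /= r0 rO] : nbhs m O by exact: open_nbhs_nbhs.
  near=> s.
  have ms : m < s by near: s; exact: nbhs_right_gt.
  have sb : s <= b by near: s; exact: nbhs_right_le.
  have sr : s < m + r by near: s; apply: nbhs_right_lt; rewrite ltrDl.
  have := uL i am (ltW ms) sb.
  rewrite ler_norml => /andP[_].
  have := Pm i.
  have : barrier O e m + L * (s - m) <= barrier O e s.
    apply: (barrier_open oO (ltW e0) am (ltW ms)).
    move=> x /=; rewrite in_itv/= => /andP[mx xs].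
    apply: rO; rewrite /ball_/= ltr0_norm ?subr_lt0// opprB ltrBlDl.
    exact: le_lt_trans xs _.
  lra.
have [imax|] := pselect (forall j, u j m <= u i m).
  have [|l l0 ul] := uE m _ (fun Em => nOm (EO _ Em)) i imax; first by rewrite am.
  have := is_derive_le0_near_right ul l0 e0.
  move=> H; near=> s.
  have ms : m < s by near: s; exact: nbhs_right_gt.
  have := barrier_homo oO (ltW e0) am (ltW ms).
  have := Pm i.
  have : u i s <= u i m + e * (s - m) by near: s.
  lra.
(* The strict gap below [u j m] leaves component [i] room to grow at rate [L] for a while without
   passing the level [u j m], which is already under the barrier. *)
move=> /existsNP[j /negP]; rewrite -ltNge => ij.
have L1 : 0 < L + 1 by rewrite ltr_wpDl.
have d0 : 0 < (u j m - u i m) / (L + 1) by rewrite divr_gt0// subr_gt0.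
near=> s.
have ms : m < s by near: s; exact: nbhs_right_gt.
have sb : s <= b by near: s; exact: nbhs_right_le.
have sr : s < m + (u j m - u i m) / (L + 1).
  by near: s; apply: nbhs_right_lt; rewrite ltrDl.
have := uL i am (ltW ms) sb.
rewrite ler_norml => /andP[_].
have := barrier_homo oO (ltW e0) am (ltW ms).
have := Pm j.
have : (L + 1) * (s - m) <= u j m - u i m.
  by rewrite mulrC -ler_pdivlMr// ltW// ltrBlDl.
have : 0 <= e * (s - m) by rewrite mulr_ge0 ?ltW// subr_gt0.
lra.
Unshelve. all: by end_near. Qed.

(** Outer regularity covers the exceptional null set by an open set of measure at most [e]; the
    barrier at [b] is then as small as desired. *)
Lemma le_of_ae_derive_max_le0 (c : R) :
  {ae mu, forall t, a <= t < b -> forall i, (forall j, u j t <= u i t) ->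
    exists2 l : R, l <= 0 & is_derive t 1 (u i) l} ->
  (forall i, u i a <= c) -> forall i, u i b <= c.
Proof.
move=> [E [mE E0 subE]] uc i.
apply/ler_addgt0Pr => z z0.
(* Chosen so that [L * e + e * (b - a) <= z]; the added 1 keeps the denominator positive. *)
pose e := z / (L + (b - a) + 1).
have K0 : 0 < L + (b - a) + 1 by rewrite ltr_wpDl// addr_ge0// subr_ge0.
have e0 : 0 < e by rewrite divr_gt0.
have muE : (mu E < +oo)%E by rewrite E0.
have [U [oO EO OE]] := lebesgue_regularity_outer mE muE e0.
have mO : measurable U by exact: open_measurable.
have muO : (mu U <= e%:E)%E.
  have -> : U = (E `|` (U `\` E))%classic.
    by rewrite setDUK.
  apply: (le_trans (measureU2 _ mE (measurableD mO mE))).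
  by rewrite [X in (X + _)%E]E0 add0e; exact: ltW OE.
have := @barrier_dominates U E e c oO EO e0 _ uc i.
move=> /(_ _)/le_trans; apply.
  by move=> t tab nEt; apply: (contra_notP _ nEt) => nP; apply: subE => /= /(_ tab).
rewrite lerD2l /barrier.
apply: (@le_trans _ _ (L * e + e * (b - a))).
  rewrite lerD2r ler_wpM2l//.
  have -> : e = fine e%:E by [].
  apply: fine_le => //; first exact: fin_itv.
  by apply: le_trans muO; apply: le_measure; rewrite ?inE//; exact: measurableI.
have -> : L * e + e * (b - a) = e * (L + (b - a)) by ring.
rewrite /e mulrAC ler_pdivrMr// ler_pM2l// lerDl//.
Qed.

End max_principle.

(** * Primitives of bounded measurable functions *)

Lemma ae_lebesgue_imply (R : realType) (P Q : R -> Prop) : (forall t, P t -> Q t) ->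
  {ae (@lebesgue_measure R), forall t, P t} -> {ae (@lebesgue_measure R), forall t, Q t}.
Proof.
by move=> PQ; apply: filterS => //; exact: (ae_filter_ringOfSetsType (@lebesgue_measure R)).
Qed.

Lemma ae_lebesgue_imply2 (R : realType) (P Q S : R -> Prop) :
  (forall t, P t -> Q t -> S t) ->
  {ae (@lebesgue_measure R), forall t, P t} -> {ae (@lebesgue_measure R), forall t, Q t} ->
  {ae (@lebesgue_measure R), forall t, S t}.
Proof.
by move=> PQS; apply: filterS2 => //; exact: (ae_filter_ringOfSetsType (@lebesgue_measure R)).
Qed.

(** Serves to discard the time 0, which belongs to [[0, T[] but where [cutoff] returns 0. *)
Lemma ae_lebesgue_neq (R : realType) (c : R) : {ae (@lebesgue_measure R), forall t, t != c}.
Proof.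
exists [set c]; split; [exact: measurable_set1|exact: lebesgue_measure_set1|].
by move=> t /=; apply: contra_notP => /eqP.
Qed.

Lemma ae_lebesgue_forall (R : realType) (I : finType) (P : I -> R -> Prop) :
  (forall i, {ae (@lebesgue_measure R), forall t, P i t}) ->
  {ae (@lebesgue_measure R), forall t, forall i, P i t}.
Proof.
by move=> Pi; apply: filter_forall => //; exact: (ae_filter_ringOfSetsType (@lebesgue_measure R)).
Qed.

Section primitive.
Context {R : realType} (T : R).
Local Notation mu := (@lebesgue_measure R).

Lemma bounded_itv_integrable (f : R -> R) (A : set R) (a b : R) :
  measurable_fun [set: R] f -> (exists B : R, forall t : R, `|f t| <= B) ->
  measurable A -> A `<=` `[a, b] -> mu.-integrable A (EFin \o f).
Proof.
move=> mf [B fB] mA Aab.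
apply: (@measurable_bounded_integrable _ _ R mu f A mA).
- apply: (@le_lt_trans _ _ (mu `[a, b])).
    by apply: le_measure; rewrite ?inE//; exact: measurable_itv.
  by rewrite /= lebesgue_measure_itv/=; case: ifP => _; rewrite ?ltry.
- exact: measurable_funS mf.
- exists B; split; first exact: num_real.
  by move=> x Bx t _; rewrite /= (le_trans (fB t))// ltW.
Qed.

(** Starting at [-oo] gives a total function of time; for a [bounded_source] it is the integral from
    0, and it vanishes for [t <= 0]. *)
Definition primitive (f : R -> R) (t : R) : R := (\int[mu]_(s in `]-oo, t]) f s)%R.

Definition bounded_source (f : R -> R) :=
  [/\ measurable_fun [set: R] f, (exists B : R, forall t : R, `|f t| <= B) &
      forall t : R, ~~ (0 < t <= T) -> f t = 0].

Lemma bounded_source_integrable (f : R -> R) (A : set R) :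
  bounded_source f -> measurable A -> mu.-integrable A (EFin \o f).
Proof.
move=> [mf fB f0] mA.
apply: (@integrableS _ _ _ mu setT) => //.
have -> : EFin \o f = (EFin \o f) \_ `]0, T].
  apply/funext => t; rewrite patchE; case: ifPn => //.
  by rewrite notin_setE /= in_itv/= => /negP /f0 ->.
rewrite -integrable_mkcond; last exact: measurable_itv.
apply: (@bounded_itv_integrable f _ 0 T) => //.
by apply: subset_itvr; rewrite bnd_simp.
Qed.

Lemma bounded_sourceB (f g : R -> R) : bounded_source f -> bounded_source g ->
  bounded_source (fun t => f t - g t).
Proof.
move=> [mf [B fB] f0] [mg [C gC] g0]; split.
- exact: measurable_funB.
- by exists (B + C) => t; rewrite (le_trans (ler_normB _ _))// lerD.
- by move=> t tT; rewrite f0// g0// subrr.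
Qed.

Lemma primitive_itvB (f : R -> R) (s t : R) : bounded_source f -> s <= t ->
  primitive f t - primitive f s = \int[mu]_(r in `]s, t]) f r.
Proof.
move=> ff st; apply: Rintegral_itvB => //.
exact: bounded_source_integrable.
Qed.

Lemma primitiveB (f g : R -> R) (t : R) : bounded_source f -> bounded_source g ->
  primitive f t - primitive g t = primitive (fun s => f s - g s) t.
Proof.
by move=> ff gg; rewrite /primitive RintegralB//; apply: bounded_source_integrable.
Qed.

Lemma primitive_le0 (f : R -> R) (t : R) : bounded_source f -> t <= 0 -> primitive f t = 0.
Proof.
move=> [_ _ f0] t0; rewrite /primitive.
rewrite (@eq_Rintegral _ _ _ mu _ (cst 0)) ?Rintegral_cst ?mul0r//.
move=> s; rewrite inE/= in_itv/= => st; apply: f0.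
by rewrite negb_and -leNgt (le_trans st t0).
Qed.

Lemma primitive_dominated (f g : R -> R) (s t : R) : bounded_source f ->
  mu.-integrable `]s, t] (EFin \o g) -> s <= t ->
  (forall r : R, s < r <= t -> `|f r| <= g r) ->
  `|primitive f t - primitive f s| <= \int[mu]_(r in `]s, t]) g r.
Proof.
move=> ff ig st fg; rewrite primitive_itvB//.
have mst : measurable (`]s, t] : set R) by exact: measurable_itv.
have iff := bounded_source_integrable ff mst.
apply: le_trans; first exact: le_normr_Rintegral.
by apply: le_Rintegral => //; exact: (integrable_norm iff).
Qed.

(** Any uniform bound of the integrand is a Lipschitz constant on the whole line. *)
Lemma primitive_lipschitz (f : R -> R) : bounded_source f ->
  exists B : R, forall s t : R, `|primitive f s - primitive f t| <= B * `|s - t|.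
Proof.
move=> ff; have [mf [B fB] f0] := ff; exists B.
suff H (s t : R) : s <= t -> `|primitive f t - primitive f s| <= B * `|t - s|.
  move=> s t; have [st|/ltW ts] := leP s t; last exact: H.
  by rewrite distrC (distrC s); exact: H.
move=> st.
have mst : measurable (`]s, t] : set R) by exact: measurable_itv.
apply: (le_trans (@primitive_dominated f (cst B) s t ff _ st _)).
- apply: (@bounded_itv_integrable _ _ s t) => //.
    by exists `|B|.
  by apply: subset_itvr; rewrite bnd_simp.
- by move=> r _; exact: fB.
rewrite Rintegral_cst// /= lebesgue_measure_itv/= lte_fin.
case: ltP => /= [_|_]; first by rewrite ger0_norm// subr_ge0.
by rewrite mulr0 mulr_ge0// (le_trans _ (fB 0)).
Qed.

Lemma primitive_continuous (f : R -> R) : bounded_source f -> continuous (primitive f).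
Proof. by move=> /primitive_lipschitz[B fB]; exact: klipschitz_continuous fB. Qed.

Lemma primitive_bounded (f : R -> R) : bounded_source f ->
  exists B : R, forall t : R, t <= T -> `|primitive f t| <= B.
Proof.
move=> ff; have [B fB] := primitive_lipschitz ff; exists `|B * T| => t tT.
have [t0|t0] := leP t 0; first by rewrite primitive_le0// normr0.
have := fB t 0; rewrite (primitive_le0 ff (lexx 0)) !subr0 => /le_trans; apply.
rewrite normrM ler_pM// ?ler_norm// ?(le_trans _ (fB _ _))//.
  have := fB 1 0; rewrite subr0 normr1 mulr1; exact: le_trans.
by rewrite !gtr0_norm// (lt_le_trans t0).
Qed.

Lemma primitive_derive (f : R -> R) : bounded_source f ->
  {ae mu, forall t : R, is_derive t 1 (primitive f) (f t)}.
Proof.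
move=> ff.
have loc : locally_integrable [set: R] f.
  by apply: open_integrable_locally => //; [exact: openT|exact: bounded_source_integrable].
apply: ae_lebesgue_imply (FTC1Ny _ loc) => [t [df <-]|y].
  by rewrite derive1E; exact: derivableP.
exact: bounded_source_integrable.
Qed.

(** The contraction estimate: integrating [K * c * expR (2 * K * s)] divides by [2 * K], so the
    factor [K] is absorbed and a factor 1/2 is gained. *)
Lemma primitive_exp_bound (f : R -> R) (K c : R) : bounded_source f ->
  0 < K -> 0 <= c ->
  (forall t : R, 0 < t <= T -> `|f t| <= K * (c * expR (2 * K * t))) ->
  forall t : R, `|primitive f t| <= c / 2 * expR (2 * K * t).
Proof.
move=> ff K0 c0 fK t.
have K20 : 0 < 2 * K by rewrite mulr_gt0.
have [t0|t0] := leP t 0.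
  by rewrite primitive_le0// normr0 mulr_ge0 ?divr_ge0// expR_ge0.
pose g s := K * (c * expR (2 * K * s)).
pose G s := c / 2 * expR (2 * K * s).
have dG (s : R) : is_derive s 1 G (g s).
  rewrite /G /g.
  have -> : (fun s => c / 2 * expR (2 * K * s)) = (c / 2) \*: (expR \o ( *%R (2 * K))).
    by apply/funext.
  by apply: is_derive_eq; rewrite /GRing.scale/= mulr1; field.
have cg : continuous g.
  move=> s; apply: cvgM; first exact: cvg_cst.
  apply: cvgM; first exact: cvg_cst.
  apply: continuous_comp; last exact: continuous_expR.
  by apply: cvgM; [exact: cvg_cst|exact: cvg_id].
have ig : mu.-integrable `[0, t] (EFin \o g).
  apply: continuous_compact_integrable; first exact: segment_compact.
  exact: continuous_subspaceT.
have ig' : mu.-integrable `]0, t] (EFin \o g).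
  by apply: integrableS ig => //; apply: subset_itvr; rewrite bnd_simp.
have := @primitive_dominated f g 0 t ff ig' (ltW t0).
rewrite (primitive_le0 ff (lexx 0)) subr0 => /(_ _)/le_trans; apply.
  (* Beyond [T] the source vanishes, so the domination holds for all positive times. *)
  move=> r /andP[r0 rt]; have [rT|Tr] := leP r T; first by apply: fK; rewrite r0.
  have [_ _ ->] := ff.
    by rewrite normr0; apply: mulr_ge0; [exact: ltW|rewrite mulr_ge0 ?expR_ge0].
  by rewrite negb_and -ltNge Tr orbT.
rewrite Rintegral_itv_obnd_cbnd// /Rintegral (@continuous_FTC2 _ g G)//.
- rewrite /= /G mulr0 expR0 mulr1 lerBlDr lerDl divr_ge0//.
- exact: continuous_subspaceT.
- split.
  + by move=> s _; case: (dG s).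
  + by apply: cvg_at_right_filter; apply/differentiable_continuous/derivable1_diffP; case: (dG 0).
  + by apply: cvg_at_left_filter; apply/differentiable_continuous/derivable1_diffP; case: (dG t).
- by move=> s _; rewrite derive1E; apply: derive_val.
Qed.

End primitive.

(** * Picard iteration for linear systems *)

Lemma cvg_div_exp2 (R : realType) (c : R) : (fun n => c / 2 ^+ n) @ \oo --> 0.
Proof.
rewrite (_ : (fun n => _) = geometric c 2^-1); last first.
  by apply/funext => n; rewrite /geometric /= exprVn.
by apply: cvg_geometric; rewrite ger0_norm ?invr_ge0// invf_lt1// ltr1n.
Qed.

(** Adding and subtracting the tail [2 * C / 2 ^+ n] gives a nonincreasing and a nondecreasing
    sequence that enclose [x]; this yields both the limit and the explicit error. *)
Lemma geometric_cauchy (R : realType) (x : R^nat) (C : R) :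
  (forall n, `|x n.+1 - x n| <= C / 2 ^+ n) ->
  cvgn x /\ forall n, `|limn x - x n| <= 2 * C / 2 ^+ n.
Proof.
move=> xC.
have eE n : 2 * C / 2 ^+ n = C / 2 ^+ n + 2 * C / 2 ^+ n.+1.
  by rewrite exprS; field; rewrite expf_neq0.
have C0 n : 0 <= C / 2 ^+ n by exact: le_trans (xC n).
pose y n := x n + 2 * C / 2 ^+ n.
pose z n := x n - 2 * C / 2 ^+ n.
have zy n : z n <= y n by rewrite /z /y lerD2l ge0_cp// -mulrA mulr_ge0.
have ny : nonincreasing_seq y.
  apply/nonincreasing_seqP => n; rewrite /y (eE n).
  by have := xC n; rewrite ler_norml => /andP[_]; lra.
have nz : nondecreasing_seq z.
  apply/nondecreasing_seqP => n; rewrite /z (eE n).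
  by have := xC n; rewrite ler_norml => /andP[+ _]; lra.
have zym m n : z m <= y n.
  have [mn|/ltnW nm] := leqP m n.
    exact: le_trans (nz _ _ mn) (zy _).
  exact: le_trans (zy _) (ny _ _ nm).
have cvy : cvgn y.
  apply: nonincreasing_is_cvgn => //; exists (z 0%N) => _ [n _ <-]; exact: zym.
have e0 : (fun n => 2 * C / 2 ^+ n) @ \oo --> 0.
  exact: cvg_div_exp2.
have cvx : x @ \oo --> limn y.
  rewrite -[limn y]subr0.
  have -> : x = (fun n => y n - 2 * C / 2 ^+ n).
    by apply/funext => n; rewrite /y addrK.
  by apply: cvgB => //.
split; first by apply/cvg_ex; exists (limn y).
move=> n; rewrite (cvg_lim _ cvx)//.
rewrite ler_distl; apply/andP; split.
  by apply: limr_ge => //; apply: nearW => m; exact: zym.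
exact: nonincreasing_cvgn_ge.
Qed.

Section linear_system.
Context {R : realType} {N : nat} (T : R) (a : 'I_N -> 'I_N -> R -> R).
Local Notation mu := (@lebesgue_measure R).

(** Right-hand side of a scalar consensus system with time-dependent coefficients; every linear form
    of the velocities obeys such a system. *)
Definition drift (u : 'I_N -> R -> R) (i : 'I_N) (t : R) : R :=
  \sum_j a i j t * (u j t - u i t).

Context (A : R).
Hypothesis ma : forall i j, measurable_fun [set: R] (a i j).
Hypothesis aA : forall i j t, `|a i j t| <= A.

(** A drift has [N] terms, each at most [A] times a difference of two values; the added 1 makes [K]
    positive even when [A] is 0. *)
Let K : R := 2 * (N%:R * A) + 1.

(** The index witnesses that there is a particle; without one the bound on the coefficients says
    nothing about [A]. *)
Let A_ge0 (i : 'I_N) : 0 <= A.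
Proof. exact: le_trans (aA i i 0). Qed.

Let K_gt0 (i : 'I_N) : 0 < K.
Proof. by rewrite ltr_wpDl// !mulr_ge0// (A_ge0 i). Qed.

Lemma drift_le (u : 'I_N -> R -> R) (i : 'I_N) (t C : R) :
  (forall j, `|u j t| <= C) -> `|drift u i t| <= K * C.
Proof.
move=> uC; have C0 : 0 <= C by exact: le_trans (uC i).
apply: le_trans; first exact: ler_norm_sum.
apply: (@le_trans _ _ (\sum_(j < N) A * (C + C))).
  apply: ler_sum => j _; rewrite normrM ler_pM//.
  by rewrite (le_trans (ler_normB _ _))// lerD.
rewrite sumr_const card_ord -mulr_natl /K mulrDl mul1r.
by rewrite -[leLHS]addr0 lerD// le_eqVlt; apply/orP; left; apply/eqP; ring.
Qed.

Lemma driftB (u w : 'I_N -> R -> R) (i : 'I_N) (t : R) :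
  drift u i t - drift w i t = drift (fun j s => u j s - w j s) i t.
Proof. by rewrite /drift -sumrB; apply: eq_bigr => j _; ring. Qed.

Definition cutoff (f : R -> R) (t : R) : R := if 0 < t <= T then f t else 0.

(** The class preserved by the Picard map and by the limit of its iterates; it guarantees that the
    truncated drift can be integrated. *)
Definition admissible (u : 'I_N -> R -> R) : Prop :=
  (forall i, measurable_fun [set: R] (u i)) /\
  (forall i, exists B : R, forall t : R, t <= T -> `|u i t| <= B).

Lemma cutoff_source (f : R -> R) : measurable_fun [set: R] f ->
  (exists B : R, forall t : R, 0 < t <= T -> `|f t| <= B) -> bounded_source T (cutoff f).
Proof.
move=> mf [B fB]; split.
- rewrite (_ : cutoff f = f \_ `]0, T]).
    have m0T : measurable (`]0, T] : set R) by exact: measurable_itv.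
    apply: (measurable_restrictT f m0T).1.
    exact: measurable_funS mf.
  by apply/funext => t; rewrite patchE mem_setE in_itv.
- exists `|B| => t; rewrite /cutoff; case: ifPn => [/fB|_].
    by move=> /le_trans; apply; exact: ler_norm.
  by rewrite normr0.
- by move=> t /negPf tT; rewrite /cutoff tT.
Qed.

Lemma drift_source (u : 'I_N -> R -> R) (i : 'I_N) : admissible u ->
  bounded_source T (cutoff (drift u i)).
Proof.
move=> [mu' bu]; apply: cutoff_source.
  apply: measurable_sum => j; apply: measurable_funM => //.
  exact: measurable_funB.
have {}bu j := cid (bu j).
exists (K * \sum_j `|projT1 (bu j)|) => t /andP[_ tT].
apply: drift_le => j; rewrite (bigD1 j)//=.
rewrite (le_trans (projT2 (bu j) t tT))// (le_trans (ler_norm _))// lerDl.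
exact: sumr_ge0.
Qed.

Context (c : 'I_N -> R).

Let picard (u : 'I_N -> R -> R) (i : 'I_N) (t : R) : R :=
  c i + primitive (cutoff (drift u i)) t.

Let picard_admissible u : admissible u -> admissible (picard u).
Proof.
move=> uu; split => i.
  apply: measurable_funD; first exact: measurable_cst.
  by apply: continuous_measurable_fun; exact/primitive_continuous/drift_source.
have [B pB] := primitive_bounded (drift_source i uu).
by exists (`|c i| + B) => t /pB pt; rewrite (le_trans (ler_normD _ _))// lerD.
Qed.

Let weight (t : R) : R := expR (2 * K * t).

(** By linearity the difference is the primitive of the drift of [u - w], which is at most [K * C]
    times the weight; integration halves the constant. *)
Let picard_contraction u w C : admissible u -> admissible w -> 0 <= C ->
  (forall i t, `|u i t - w i t| <= C * weight t) ->
  forall i t, `|picard u i t - picard w i t| <= C / 2 * weight t.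
Proof.
move=> uu ww C0 uwC i t.
rewrite /picard opprD addrACA subrr add0r (@primitiveB _ T); [|exact: drift_source..].
apply: (@primitive_exp_bound _ T) => //.
- by apply: bounded_sourceB; exact: drift_source.
- exact: K_gt0 i.
- move=> s sT; rewrite /cutoff sT driftB; apply: drift_le => j; exact: uwC.
Qed.

Let U (n : nat) : 'I_N -> R -> R := iter n picard (fun i _ => c i).

Let admissible_U n : admissible (U n).
Proof.
elim: n => [|n IH]; last exact: picard_admissible.
by split => i; [exact: measurable_cst|exists `|c i|].
Qed.

Let C0 : R := \sum_i `|c i|.

Let C0_ge0 : 0 <= C0. Proof. exact: sumr_ge0. Qed.

Let U_step n i t : `|U n.+1 i t - U n i t| <= C0 * weight t / 2 ^+ n.
Proof.
suff : `|U n.+1 i t - U n i t| <= C0 / 2 ^+ n * weight t by rewrite mulrAC.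
elim: n i t => [|n IH] i t.
  rewrite expr0 divr1 /= /picard addrAC subrr add0r.
  (* The first step already gains 1/2, which is given up to match the form of the induction. *)
  apply: (@le_trans _ _ (C0 / 2 * weight t)); last first.
    by rewrite ler_pM2r ?expR_gt0// ler_pdivrMr// ler_peMr// ler1n.
  apply: (@primitive_exp_bound _ T) => //.
  - by apply: drift_source; exact: (admissible_U 0).
  - exact: K_gt0 i.
  - move=> s sT; rewrite /cutoff sT; apply: drift_le => j /=.
    apply: (@le_trans _ _ C0).
      by rewrite /C0 (bigD1 j)//= lerDl; exact: sumr_ge0.
    rewrite ler_peMr// -expR0 ler_expR.
    by case/andP: sT => /ltW s0 _; rewrite !mulr_ge0// ltW// (K_gt0 i).
rewrite exprSr invfM mulrA.
apply: (picard_contraction (admissible_U n.+1) (admissible_U n) _ IH).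
by rewrite divr_ge0// exprn_ge0.
Qed.

Let u (i : 'I_N) (t : R) : R := limn (fun n => U n i t).

Let u_cvg i t : cvgn (fun n => U n i t).
Proof. exact: (geometric_cauchy (fun n => U_step n i t)).1. Qed.

Let u_dist n i t : `|u i t - U n i t| <= 2 * C0 / 2 ^+ n * weight t.
Proof.
have := (geometric_cauchy (fun n => U_step n i t)).2 n.
by rewrite mulrA mulrAC.
Qed.

(** Measurability passes to the pointwise limit, and the distance to the constant iterate [U 0] is
    bounded up to time [T] because the weight is increasing. *)
Let admissible_u : admissible u.
Proof.
split => i.
  apply: (@measurable_fun_cvg _ _ _ _ (fun n => U n i)) => [n|t _].
    exact: (admissible_U n).1.
  exact: u_cvg.
exists (`|c i| + 2 * C0 * weight T) => t tT.
rewrite -[u i t](subrK (c i)) addrC (le_trans (ler_normD _ _))// lerD2l.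
have := u_dist 0 i t; rewrite /= expr0 divr1 => /le_trans; apply.
rewrite ler_wpM2l ?mulr_ge0// ler_expR ler_wpM2l// mulr_ge0// ltW//.
exact: K_gt0 i.
Qed.

(** Both sides are compared with [U n.+1]: each error is at most half of
    [2 * C0 * weight t / 2 ^+ n], which tends to 0. *)
Let u_fixpoint i t : u i t = picard u i t.
Proof.
have H n : `|u i t - picard u i t| <= 2 * C0 * weight t / 2 ^+ n.
  have := picard_contraction (admissible_U n) admissible_u _ _ i t.
  move=> /(_ (2 * C0 / 2 ^+ n)).
  rewrite divr_ge0 ?mulr_ge0 ?exprn_ge0// => /(_ isT).
  have uU : forall i t, `|U n i t - u i t| <= 2 * C0 / 2 ^+ n * weight t.
    by move=> j s; rewrite distrC; exact: u_dist.
  move=> /(_ uU) H1.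
  have := u_dist n.+1 i t.
  rewrite exprS invfM => H2.
  rewrite -(subrK (U n.+1 i t) (u i t)) -addrA (le_trans (ler_normD _ _))//.
  rewrite /= in H1 H2 *; lra.
apply/eqP; rewrite -subr_eq0 -normr_le0.
have e0 := @cvg_div_exp2 R (2 * C0 * weight t).
rewrite -(cvg_lim _ e0)//; apply: limr_ge; first by apply/cvg_ex; exists 0.
exact: nearW.
Qed.

Lemma linear_system_solution : exists u : 'I_N -> R -> R,
  [/\ forall i, exists L : R, forall s t : R, `|u i s - u i t| <= L * `|s - t|,
      forall i, u i 0 = c i &
      forall i, {ae mu, forall t : R, 0 < t <= T -> is_derive t 1 (u i) (drift u i t)}].
Proof.
exists u; have su i := drift_source i admissible_u; split => i.
- have [L pL] := primitive_lipschitz (su i); exists L => s t.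
  by rewrite !u_fixpoint /picard opprD addrACA subrr add0r.
- by rewrite u_fixpoint /picard (primitive_le0 (su i))// addr0.
- apply: ae_lebesgue_imply (primitive_derive (su i)) => t ut tT.
  have -> : u i = cst (c i) + primitive (cutoff (drift u i)).
    by apply/funext => s; rewrite u_fixpoint.
  have -> : drift u i t = 0 + cutoff (drift u i) t by rewrite add0r /cutoff tT.
  exact: is_deriveD.
Qed.

End linear_system.

(** * Maximum principle for linear systems *)

Section maximum_principle.
Context {R : realType} {N : nat}.
Local Notation mu := (@lebesgue_measure R).
Implicit Types (a b : 'I_N -> 'I_N -> R -> R) (u w : 'I_N -> R -> R).

Definition solves_on a u (s t : R) : Prop :=
  (forall i, exists L : R, forall p q : R, s <= p -> p <= q -> q <= t ->
     `|u i q - u i p| <= L * (q - p)) /\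
  forall i, {ae mu, forall r : R, s <= r < t -> is_derive r 1 (u i) (drift a u i r)}.

(** At a maximal component every term [a i j r * (u j r - u i r)] is nonpositive, so the general
    maximum principle applies. *)
Lemma solves_on_le a u (s t c : R) : s <= t ->
  (forall i j r, 0 <= a i j r) -> solves_on a u s t ->
  (forall i, u i s <= c) -> forall i, u i t <= c.
Proof.
move=> st a0 [Lu ae_u] uc.
have {Lu} Lu i := cid (Lu i).
(* One Lipschitz constant common to all components. *)
pose L := \sum_i `|projT1 (Lu i)|.
apply: (@le_of_ae_derive_max_le0 R 'I_N u s t L st) => //.
- exact: sumr_ge0.
- move=> i p q sp pq qt; apply: (le_trans (projT2 (Lu i) p q sp pq qt)).
  rewrite ler_wpM2r ?subr_ge0//.
  rewrite (le_trans (ler_norm _))// /L (bigD1 i)//= lerDl.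
  exact: sumr_ge0.
- apply: ae_lebesgue_imply (ae_lebesgue_forall ae_u) => r ur rst i imax.
  exists (drift a u i r); last exact: ur.
  apply: sumr_le0 => j _; apply: mulr_ge0_le0 => //.
  by rewrite subr_le0.
Qed.

Lemma solves_onN a u (s t : R) : solves_on a u s t -> solves_on a (fun i r => - u i r) s t.
Proof.
move=> [Lu ae_u]; split => i.
  have [L uL] := Lu i; exists L => p q sp pq qt.
  by rewrite -opprD normrN; exact: uL.
apply: ae_lebesgue_imply (ae_u i) => r ur /ur {}ur.
have -> : drift a (fun i r => - u i r) i r = - drift a u i r.
  by rewrite /drift -sumrN; apply: eq_bigr => j _; ring.
exact: is_deriveN.
Qed.

(** Requiring the two families of coefficients to agree only on [[s, t[] makes it possible to
    compare two trajectories that share only their past. *)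
Lemma solves_onB a b u w (s t : R) : (forall i j r, s <= r < t -> a i j r = b i j r) ->
  solves_on a u s t -> solves_on b w s t -> solves_on a (fun i r => u i r - w i r) s t.
Proof.
move=> ab [Lu ae_u] [Lw ae_w]; split => i.
  have [L uL] := Lu i; have [K wK] := Lw i; exists (L + K) => p q sp pq qt.
  have -> : u i q - w i q - (u i p - w i p) = (u i q - u i p) - (w i q - w i p) by ring.
  by rewrite (le_trans (ler_normB _ _))// mulrDl lerD// ?uL ?wK.
apply: ae_lebesgue_imply2 (ae_u i) (ae_w i) => r + + rst => /(_ rst) ur /(_ rst) wr.
have -> : drift a (fun i r => u i r - w i r) i r = drift a u i r - drift b w i r.
  rewrite /drift -sumrB; apply: eq_bigr => j _; rewrite -ab//; ring.
exact: is_deriveB.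
Qed.

Lemma solves_on_eq0 a u (s t : R) : s <= t ->
  (forall i j r, 0 <= a i j r) -> solves_on a u s t ->
  (forall i, u i s = 0) -> forall i, u i t = 0.
Proof.
move=> st a0 au us i; apply/eqP; rewrite eq_le.
rewrite (solves_on_le st a0 au) => [|j]; last by rewrite us.
rewrite -oppr_le0 (solves_on_le st a0 (solves_onN au))// => j.
by rewrite us oppr0.
Qed.

End maximum_principle.

(** * Pairings with linear forms and coordinatewise calculus for row vectors *)

Section vector_valued.
Context {R : realType} {d : nat}.
Implicit Types (xi : 'rV[R]_d) (f : R -> 'rV[R]_d).

Definition dot xi (y : 'rV[R]_d) : R := \sum_k xi 0 k * y 0 k.

Lemma dotBr xi y z : dot xi (y - z) = dot xi y - dot xi z.
Proof. by rewrite /dot -sumrB; apply: eq_bigr => k _; rewrite !mxE mulrBr. Qed.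

Lemma dotBl xi y z : dot (y - z) xi = dot y xi - dot z xi.
Proof. by rewrite /dot -sumrB; apply: eq_bigr => k _; rewrite !mxE mulrBl. Qed.

Lemma dotNl xi y : dot (- xi) y = - dot xi y.
Proof. by rewrite /dot -sumrN; apply: eq_bigr => k _; rewrite !mxE mulNr. Qed.

Lemma dotZr xi c y : dot xi (c *: y) = c * dot xi y.
Proof. by rewrite /dot mulr_sumr; apply: eq_bigr => k _; rewrite !mxE mulrCA. Qed.

Lemma dot_sumr xi (I : finType) (P : pred I) (F : I -> 'rV[R]_d) :
  dot xi (\sum_(i | P i) F i) = \sum_(i | P i) dot xi (F i).
Proof.
rewrite /dot exchange_big/=; apply: eq_bigr => k _.
by rewrite summxE mulr_sumr.
Qed.

Lemma dot_delta k y : dot (delta_mx 0 k) y = y 0 k.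
Proof.
rewrite /dot (bigD1 k)//= mxE !eqxx mul1r big1 ?addr0// => j jk.
by rewrite mxE eqxx (negPf jk) mul0r.
Qed.

Lemma dot_inj y z : (forall xi, dot xi y = dot xi z) -> y = z.
Proof. by move=> yz; apply/rowP => k; rewrite -!dot_delta. Qed.

Lemma enormE y : enorm y = Num.sqrt (dot y y).
Proof. by rewrite /enorm; congr Num.sqrt; apply: eq_bigr => k _; rewrite expr2. Qed.

Lemma dot_ge0 y : 0 <= dot y y.
Proof. by apply: sumr_ge0 => k _; rewrite -expr2 sqr_ge0. Qed.

(** Expanding the nonnegative square of [y - z] bounds [2 * dot y z] by [dot y y + dot z z]. *)
Lemma enorm_le_dot y z : dot y y <= dot y z -> enorm y <= enorm z.
Proof.
move=> yz; rewrite !enormE ler_sqrt ?dot_ge0//.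
have : 0 <= dot (y - z) (y - z) by exact: dot_ge0.
have zyE : dot z y = dot y z by apply: eq_bigr => k _; rewrite mulrC.
rewrite !(dotBr, dotBl) zyE; lra.
Qed.

Lemma coord_le_norm (y : 'rV[R]_d) k : `|y 0 k| <= `|y|.
Proof. by rewrite [leRHS]mx_normrE; exact: (le_bigmax _ _ (0, k)). Qed.

Lemma norm_le_coord (y : 'rV[R]_d) (C : R) : 0 <= C ->
  (forall k, `|y 0 k| <= C) -> `|y| <= C.
Proof.
move=> C0 yC; rewrite [leLHS]mx_normrE; apply: bigmax_le => //= -[i k] _ /=.
by rewrite ord1.
Qed.

Lemma is_derive_dot xi f (t : R) (l : 'rV[R]_d) : is_derive t 1 f l ->
  is_derive t 1 (fun s => dot xi (f s)) (dot xi l).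
Proof.
move=> fl; have /derivable_mxP df : derivable f t 1 by case: fl.
have lE : l = 'D_1 f t by rewrite derive_val.
have -> : (fun s => dot xi (f s)) = \sum_k (xi 0 k *: (fun s => f s 0 k)).
  by apply/funext => s; rewrite fct_sumE.
apply: is_derive_sum => k; apply: is_deriveZ.
have -> : l 0 k = 'D_1 (fun s => f s 0 k) t.
  by rewrite lE derive_mx ?mxE//; case: fl.
exact: derivableP.
Qed.

Lemma is_derive_row f (t : R) (l : 'rV[R]_d) :
  (forall k, is_derive t 1 (fun s => f s 0 k) (l 0 k)) -> is_derive t 1 f l.
Proof.
move=> fl; have df : derivable f t 1.
  by apply/derivable_mxP => i k; rewrite ord1; case: (fl k).
apply: DeriveDef => //; rewrite derive_mx//; apply/rowP => k; rewrite mxE.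
exact: derive_val.
Qed.

Lemma lipschitz_dot xi f (A : set R) : [lipschitz f t | t in A] ->
  exists L : R, forall p q : R, A p -> A q -> `|dot xi (f q) - dot xi (f p)| <= L * `|q - p|.
Proof.
move=> /pinfty_ex_gt0[L L0 fL].
exists (\sum_k `|xi 0 k| * L) => p q Ap Aq.
rewrite -dotBr mulr_suml; apply: le_trans; first exact: ler_norm_sum.
apply: ler_sum => k _; rewrite normrM -mulrA ler_wpM2l//.
by apply: le_trans (coord_le_norm _ _) _; exact: (fL (q, p)).
Qed.

Lemma lipschitz_row f (A : set R) :
  (forall k, exists L : R, forall p q : R, `|f p 0 k - f q 0 k| <= L * `|p - q|) ->
  [lipschitz f t | t in A].
Proof.
move=> fL; have {}fL k := cid (fL k).
pose L : R := \sum_k `|projT1 (fL k)|.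
exists L; split; first exact: num_real.
move=> M /ltW LM -[p q] _ /=.
have L0 : 0 <= L by exact: sumr_ge0.
apply: norm_le_coord => [|k].
  by rewrite mulr_ge0// (le_trans L0).
rewrite !mxE (le_trans (projT2 (fL k) p q))// ler_wpM2r//.
apply: le_trans LM; rewrite (le_trans (ler_norm _))// /L (bigD1 k)//= lerDl.
exact: sumr_ge0.
Qed.

End vector_valued.

(** * The delayed system *)

(** The composite is a finite sum over all sets [S] of [g S] times a product that equals 1 when [S]
    is the current set and 0 otherwise, hence measurable. *)
Lemma measurable_fun_finset (R : realType) (I : finType) (P : I -> R -> bool)
    (g : {set I} -> R) : (forall l, measurable_fun [set: R] (P l)) ->
  measurable_fun [set: R] (fun t => g [set l | P l t]%SET).
Proof.
move=> mP.
have -> : (fun t => g [set l | P l t]%SET) = (fun t => \sum_(S : {set I})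
    g S * \prod_(l : I) (if P l t then (l \in S)%:R else (l \notin S)%:R)).
  apply/funext => t; rewrite (bigD1 [set l | P l t]%SET)//=.
  rewrite [X in g _ * X]big1 => [|l _]; last by rewrite inE; case: (P l t).
  rewrite mulr1 big1 ?addr0// => S SP.
  suff [l lS] : exists l, P l t != (l \in S).
    rewrite (bigD1 l)//=; case: (P l t) lS; case: (l \in S) => //= _; by rewrite mul0r mulr0.
  apply/existsP; apply: contraNT SP; rewrite negb_exists => /forallP PS.
  by apply/eqP/setP => l; rewrite inE; have := PS l; rewrite negbK => /eqP ->.
apply: measurable_sum => S; apply: measurable_funM => //.
by apply: measurable_prod => l _; exact: measurable_fun_ifT.
Qed.

Lemma delayed_ge0 (R : realType) (h t : R) : 0 <= delayed h t.
Proof. by rewrite /delayed; case: ltP => //; rewrite subr_ge0. Qed.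

(** The gain of one delay: up to time [b + h] the system only looks at times up to [b]. Before [h]
    it looks at 0, whence [0 <= b]. *)
Lemma delayed_le (R : realType) (h t b : R) : 0 <= b -> t <= b + h -> delayed h t <= b.
Proof. by move=> b0 tb; rewrite /delayed; case: ltP => // _; rewrite lerBlDr. Qed.

Lemma measurable_delayed (R : realType) (h : R) : measurable_fun [set: R] (delayed h).
Proof.
apply: measurable_fun_ifT => //; first exact: measurable_fun_ltr.
exact: measurable_funB.
Qed.

Section delayed_system.
Context {R : realType} {N d : nat} (T m delta h : R) (M : 'I_N -> nat -> R).
Context (x0 v0 : 'I_N -> 'rV[R]_d).
Hypothesis hh : 0 < h.
Hypothesis hM : forall (i : 'I_N) (n : nat), (0 < n <= N)%N -> 0 < M i n.
Local Notation mu := (@lebesgue_measure R).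
Implicit Types (X Y x y v w : 'I_N -> R -> 'rV[R]_d).

Local Notation nbr := (@neighbors R N d m delta h).

(** Extending by 0 off the neighbor set turns a sum over a varying set into one over all particles,
    with coefficients depending on time. *)
Definition weight X (i j : 'I_N) (t : R) : R :=
  if j \in nbr X i t then M i #|nbr X i t| else 0.

Lemma weight_ge0 X i j t : 0 <= weight X i j t.
Proof.
rewrite /weight; case: ifPn => // jn; apply/ltW/hM.
(* Since [j] itself is a neighbor, the count lies between 1 and [N], the range where [M] is known to
   be positive. *)
by rewrite (leq_trans (max_card _)) ?card_ord// andbT; apply/card_gt0P; exists j.
Qed.

(** A weight takes finitely many values; summing over all indices and all sets bounds them
    uniformly. *)
Lemma weight_bounded X i j t :
  `|weight X i j t| <= \sum_(k : 'I_N) \sum_(S : {set 'I_N}) `|M k #|S| |.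
Proof.
apply: (@le_trans _ _ `|M i #|nbr X i t| |).
  by rewrite /weight; case: ifP; rewrite ?normr0.
rewrite (bigD1 i)//= (bigD1 (nbr X i t))//= -addrA lerDl addr_ge0//.
  exact: sumr_ge0.
by apply: sumr_ge0 => k _; exact: sumr_ge0.
Qed.

Lemma eq_neighbors X Y i t : (forall j, X j (delayed h t) = Y j (delayed h t)) ->
  nbr X i t = nbr Y i t.
Proof.
move=> XY; pose nb (c : 'I_N -> 'rV[R]_d) := [set k | (c k \in eball (c i) delta) &&
  (m < #|[set l | c l \in eball (c i) delta]|%:R)]%SET.
by rewrite -/(nb (X^~ (delayed h t))) -/(nb (Y^~ (delayed h t))); congr nb; exact/funext.
Qed.

Lemma measurable_weight X i j : (forall l k, continuous (fun t => X l t 0 k)) ->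
  measurable_fun [set: R] (weight X i j).
Proof.
move=> cX.
pose P l t := X l (delayed h t) \in eball (X i (delayed h t)) delta.
(* The density threshold: a ball population that is too small is replaced by the empty set. *)
pose sel (S : {set 'I_N}) := if m < #|S|%:R then S else finset.set0.
have nbE t : nbr X i t = sel [set l | P l t]%SET.
  by apply/setP => k; rewrite /sel !inE; case: ifPn => _; rewrite ?inE ?andbT ?andbF.
pose g (S : {set 'I_N}) := if j \in sel S then M i #|sel S| else 0.
have -> : weight X i j = (fun t => g [set l | P l t]%SET).
  by apply/funext => t; rewrite /weight nbE.
apply: (@measurable_fun_finset R 'I_N P g) => l; apply: measurable_fun_ltr => //.
apply: (measurableT_comp (f := @Num.sqrt R)).
  by apply: continuous_measurable_fun; exact: sqrt_continuous.
apply: measurable_sum => k; apply: measurable_funX.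
under eq_fun do rewrite !mxE.
by apply: measurable_funB;
  apply: (measurableT_comp (continuous_measurable_fun (cX _ k)) (measurable_delayed h)).
Qed.

(* The trajectory [X] determines the neighbors; a solution is the case where [X] is [x]. *)
Record follows X x v : Prop := Follows {
  follows_lipschitz_x : forall i, [lipschitz x i t | t in `[0, T[%classic] ;
  follows_lipschitz_v : forall i, [lipschitz v i t | t in `[0, T[%classic] ;
  follows_init_x : forall i, x i 0 = x0 i ;
  follows_init_v : forall i, v i 0 = v0 i ;
  follows_eq_x : forall i, {ae mu, forall t : R,
    t \in `[0, T[ -> is_derive t 1 (x i) (v i t)} ;
  follows_eq_v : forall i, {ae mu, forall t : R,
    t \in `[0, T[ -> is_derive t 1 (v i)
      (\sum_(k in nbr X i t) M i #|nbr X i t| *: (v k t - v i t))}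
}.

Lemma is_solutionE X x v :
  (forall i t, 0 <= t < T -> X i t = x i t) ->
  follows X x v <-> is_solution T m delta h M x0 v0 x v.
Proof.
move=> Xx.
have nE i t : t \in `[0, T[ -> nbr X i t = nbr x i t.
  rewrite in_itv/= => /andP[t0 tT]; apply: eq_neighbors => j; apply: Xx.
  (* The delayed time lies in [[0, t]], hence in [[0, T[], where [X] and [x] coincide. *)
  rewrite delayed_ge0 (le_lt_trans _ tT)// delayed_le// lerDl ltW//.
split=> -[Lx Lv ix iv ex ev]; (split; [exact: Lx|exact: Lv|exact: ix|exact: iv|exact: ex|]) => i;
  by apply: ae_lebesgue_imply (ev i) => t + tT; rewrite (nE i t tT); exact.
Qed.

Lemma is_solution_follows x v : is_solution T m delta h M x0 v0 x v -> follows x x v.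
Proof. by move=> S; apply/is_solutionE. Qed.

Lemma drift_weight xi X v i t :
  dot xi (\sum_(k in nbr X i t) M i #|nbr X i t| *: (v k t - v i t)) =
  drift (weight X) (fun j s => dot xi (v j s)) i t.
Proof.
rewrite dot_sumr /drift big_mkcond/=; apply: eq_bigr => k _.
by rewrite /weight; case: ifP => _; rewrite ?mul0r// dotZr dotBr.
Qed.

Lemma solves_on_dot a (f : 'I_N -> R -> 'rV[R]_d) xi (s t : R) : 0 <= s -> t < T ->
  (forall i, [lipschitz f i r | r in `[0, T[%classic]) ->
  (forall i, {ae mu, forall r : R, s <= r < t ->
     exists2 l, is_derive r 1 (f i) l & dot xi l = drift a (fun j q => dot xi (f j q)) i r}) ->
  solves_on a (fun i r => dot xi (f i r)) s t.
Proof.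
move=> s0 tT Lf ae_f; split => i.
  have [L fL] := lipschitz_dot xi (Lf i); exists L => p q sp pq qt.
  rewrite -[q - p]ger0_norm ?subr_ge0//; apply: fL => /=; rewrite in_itv/=.
    by rewrite (le_trans s0 sp)/= (le_lt_trans _ tT)// (le_trans pq).
  by rewrite (le_trans s0 (le_trans sp pq))/= (le_lt_trans qt tT).
apply: ae_lebesgue_imply (ae_f i) => r + rst => /(_ rst)[l fl <-].
exact: is_derive_dot.
Qed.

Lemma follows_velocity X x v xi (s t : R) : 0 <= s -> t < T -> follows X x v ->
  solves_on (weight X) (fun i r => dot xi (v i r)) s t.
Proof.
move=> s0 tT F; apply: solves_on_dot => //; first exact: follows_lipschitz_v F.
move=> i; apply: ae_lebesgue_imply (follows_eq_v F i) => r + /andP[sr rt].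
rewrite in_itv/= (le_trans s0 sr) (lt_trans rt tT) => /(_ isT) vr.
by eexists; [exact: vr|exact: drift_weight].
Qed.

(** One step of the method of steps. Guides that agree up to [b] give equal coefficients up to
    [b + h]; there the velocity difference solves a linear system with zero data, and the position
    difference has zero derivative. *)
Lemma follows_agree X Y x y v w (b : R) : 0 <= b -> follows X x v -> follows Y y w ->
  (forall i s, 0 <= s <= b -> s < T -> X i s = Y i s) ->
  forall i t, 0 <= t <= b + h -> t < T -> x i t = y i t /\ v i t = w i t.
Proof.
move=> b0 Fx Fy XY.
have vw i t : 0 <= t <= b + h -> t < T -> v i t = w i t.
  move=> /andP[t0 tb] tT; apply: dot_inj => xi; apply/eqP; rewrite -subr_eq0; apply/eqP.
  have vt := follows_velocity xi (lexx 0) tT Fx.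
  have wt := follows_velocity xi (lexx 0) tT Fy.
  have XYt j k r : 0 <= r < t -> weight X j k r = weight Y j k r.
    move=> /andP[r0 rt]; rewrite /weight (@eq_neighbors X Y)// => l; apply: XY.
      by rewrite delayed_ge0 delayed_le// (le_trans (ltW rt)).
    by rewrite (le_lt_trans _ (lt_trans rt tT))// delayed_le// lerDl ltW.
  apply: (solves_on_eq0 t0 (weight_ge0 X) (solves_onB XYt vt wt)) => j.
  by rewrite (follows_init_v Fx) (follows_init_v Fy) subrr.
move=> i t tb tT; split; last exact: vw.
have /andP[t0 tbh] := tb.
apply: dot_inj => xi; apply/eqP; rewrite -subr_eq0 -dotBr; apply/eqP.
(* Zero derivative almost everywhere is the system with all coefficients 0. *)
have := @solves_on_eq0 R N (fun _ _ _ => 0) (fun j r => dot xi (x j r - y j r)) 0 t t0.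
apply => // [|j]; last by rewrite (follows_init_x Fx) (follows_init_x Fy) dotBr subrr.
apply: (@solves_on_dot _ (fun j r => x j r - y j r)) => // j.
  have := follows_lipschitz_x Fx j; have := follows_lipschitz_x Fy j.
  (* Every constant strictly above [K] or [L] is a Lipschitz constant, hence the added ones. *)
  move=> [K [Kr yK]] [L [Lr xL]]; exists (`|L| + 1 + (`|K| + 1)); split; first exact: num_real.
  move=> C /ltW LC pq Apq /=.
  have -> : x j pq.1 - y j pq.1 - (x j pq.2 - y j pq.2) =
    (x j pq.1 - x j pq.2) - (y j pq.1 - y j pq.2).
    by rewrite opprD !opprK addrACA [in RHS]opprB [in RHS]addrC addrC; congr (_ + _); rewrite addrC.
  rewrite (le_trans (ler_normB _ _))//; apply: le_trans (ler_wpM2r _ LC) => //.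
  rewrite mulrDl lerD//.
    by apply: xL => //; rewrite (le_lt_trans (ler_norm _))// ltrDl.
  by apply: yK => //; rewrite (le_lt_trans (ler_norm _))// ltrDl.
apply: ae_lebesgue_imply2 (follows_eq_x Fx j) (follows_eq_x Fy j) => r xr yr /andP[r0 rt].
have rT : r \in `[0, T[ by rewrite in_itv/= r0 (lt_trans rt tT).
exists (v j r - w j r); first by apply: is_deriveB; [exact: xr|exact: yr].
rewrite vw ?subrr; first last.
- exact: lt_trans rt tT.
- by rewrite r0 (le_trans (ltW rt)).
rewrite /drift big1 => [|k _]; last by rewrite mul0r.
by rewrite /dot big1// => k _; rewrite mxE mulr0.
Qed.

(** For a prescribed guide the coordinates decouple: each solves its own scalar linear system, and
    positions are primitives of the velocities. *)
Lemma follows_exists X : (forall i k, continuous (fun t => X i t 0 k)) ->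
  exists x v, (forall i k, continuous (fun t => x i t 0 k)) /\ follows X x v.
Proof.
move=> cX.
have ex_u k := cid (linear_system_solution T (fun i j => @measurable_weight X i j cX)
  (weight_bounded X) (fun i => v0 i 0 k)).
pose u k := projT1 (ex_u k).
have uL k i : exists L : R, forall s t : R, `|u k i s - u k i t| <= L * `|s - t|.
  by have [H _ _] := projT2 (ex_u k); exact: H.
have u0 k i : u k i 0 = v0 i 0 k by have [_ H _] := projT2 (ex_u k); exact: H.
have du k i : {ae mu, forall t : R, 0 < t <= T ->
    is_derive t 1 (u k i) (drift (weight X) (u k) i t)}.
  by have [_ _ H] := projT2 (ex_u k); exact: H.
have su k i : bounded_source T (cutoff T (u k i)).
  have [L ukL] := uL k i.
  have uc := klipschitz_continuous ukL.
  apply: cutoff_source; first exact: continuous_measurable_fun.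
  exists (`|L| * T + `|u k i 0|) => t /andP[t0 tT].
  rewrite -[u k i t](subrK (u k i 0)) (le_trans (ler_normD _ _))// lerD2r.
  rewrite (le_trans (ukL t 0))// subr0 (gtr0_norm t0).
  by rewrite (le_trans (ler_wpM2r (ltW t0) (ler_norm L)))// ler_wpM2l.
exists (fun i t => \row_k (x0 i 0 k + primitive (cutoff T (u k i)) t)).
exists (fun i t => \row_k u k i t).
split=> [i k|].
  under eq_fun do rewrite mxE.
  by move=> t; apply: cvgD; [exact: cvg_cst|exact: primitive_continuous (su k i) t].
split=> i.
- apply: lipschitz_row => k; have [L pL] := primitive_lipschitz (su k i).
  by exists L => p q; rewrite !mxE opprD addrACA subrr add0r.
- by apply: lipschitz_row => k; have [L kL] := uL k i; exists L => p q; rewrite !mxE.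
- by apply/rowP => k; rewrite mxE (primitive_le0 (su k i))// addr0.
- by apply/rowP => k; rewrite mxE u0.
- apply: ae_lebesgue_imply2 (ae_lebesgue_neq 0)
    (ae_lebesgue_forall (fun k => primitive_derive (su k i))) => t tn0 pt.
  rewrite in_itv/= => /andP[t0 tT]; apply: is_derive_row => k; rewrite mxE.
  have -> : (fun s => (\row_k0 (x0 i 0 k0 + primitive (cutoff T (u k0 i)) s)) 0 k) =
      cst (x0 i 0 k) + primitive (cutoff T (u k i)).
    by apply/funext => s; rewrite mxE.
  have -> : u k i t = 0 + cutoff T (u k i) t.
    by rewrite add0r /cutoff lt_neqAle eq_sym tn0 t0 ltW.
  exact: is_deriveD.
- apply: ae_lebesgue_imply2 (ae_lebesgue_neq 0)
    (ae_lebesgue_forall (du^~ i)) => t tn0 dt.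
  rewrite in_itv/= => /andP[t0 tT]; apply: is_derive_row => k.
  rewrite -dot_delta (drift_weight _ _ (fun j s => \row_k0 u k0 j s)).
  have -> : (fun s => (\row_k0 u k0 i s) 0 k) = u k i.
    by apply/funext => s; rewrite mxE.
  have -> : (fun j s => dot (delta_mx 0 k) (\row_k0 u k0 j s)) = u k.
    by apply/funext => j; apply/funext => s; rewrite dot_delta mxE.
  by apply: dt; rewrite lt_neqAle eq_sym tn0 t0 ltW.
Qed.

(** The positions [x] become the next guide, and [follows_agree] extends the agreement by [h].
    Continuity is carried along so that the new guide has measurable weights. *)
Lemma approximate_solution (n : nat) : exists X x v,
  [/\ forall i k, continuous (fun t => x i t 0 k), follows X x v &
      forall i s, 0 <= s <= n%:R * h -> s < T -> X i s = x i s].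
Proof.
elim: n => [|n [X [x [v [cx F Xx]]]]].
  have [|x [v [cx F]]] := @follows_exists (fun i _ => x0 i).
    by move=> i k t; exact: cvg_cst.
  (* The first guide is frozen at the initial positions and need only be exact at time 0. *)
  exists (fun i _ => x0 i), x, v; split=> // i s.
  by rewrite mul0r => /le_anti <- _; rewrite (follows_init_x F).
have [y [w [cy G]]] := follows_exists cx.
exists x, y, w; split=> // i s; rewrite -natr1 mulrDl mul1r => s0n sT.
have nh0 : 0 <= n%:R * h by rewrite mulr_ge0// ltW.
by have [] := follows_agree nh0 F G Xx i s0n sT.
Qed.

Let steps : nat := Num.bound (T / h).

Let lt_steps t : t < T -> t <= steps%:R * h.
Proof.
have [T0|T0] := leP 0 T; last first.
  by move=> /lt_trans/(_ T0)/ltW/le_trans; apply; rewrite mulr_ge0// ltW.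
move=> tT; rewrite -ler_pdivrMr// ltW// (lt_trans _ (archi_boundP _))//.
  by rewrite ltr_pM2r// invr_gt0.
by rewrite divr_ge0// ltW.
Qed.

Lemma solution_exists : exists x v, is_solution T m delta h M x0 v0 x v.
Proof.
have [X [x [v [_ F Xx]]]] := approximate_solution steps.
exists x, v; apply: (@is_solutionE X x v _).1 F => i t /andP[t0 tT].
by apply: Xx => //; rewrite t0 lt_steps.
Qed.

(** Each solution is its own guide, so agreement on [[0, n * h]] propagates by one delay, starting
    from the common initial data. *)
Lemma solution_unique x v y w :
  is_solution T m delta h M x0 v0 x v -> is_solution T m delta h M x0 v0 y w ->
  forall i t, 0 <= t < T -> y i t = x i t /\ w i t = v i t.
Proof.
move=> /is_solution_follows F.
move=> /is_solution_follows G i t /andP[t0 tT].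
suff H n : forall i s, 0 <= s <= n%:R * h -> s < T -> y i s = x i s /\ w i s = v i s.
  by apply: (H steps) => //; rewrite t0 lt_steps.
elim: n => [|n IH] j s.
  rewrite mul0r => /le_anti <- _.
  by rewrite (follows_init_x F) (follows_init_x G) (follows_init_v F) (follows_init_v G).
rewrite -natr1 mulrDl mul1r => s0n sT.
have nh0 : 0 <= n%:R * h by rewrite mulr_ge0// ltW.
have yx k r : 0 <= r <= n%:R * h -> r < T -> y k r = x k r.
  by move=> rn rT; exact: (IH k r rn rT).1.
exact: (follows_agree nh0 G F yx j s0n sT).
Qed.

Lemma vel_diam_le x v (s t : R) : is_solution T m delta h M x0 v0 x v ->
  0 <= s -> s <= t -> t < T -> vel_diam v t <= vel_diam v s.
Proof.
move=> /is_solution_follows F s0 st tT.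
(* For each linear form, the particle maximizing it at time [s] bounds all particles at time [t]. *)
have support xi i : exists p, dot xi (v i t) <= dot xi (v p s).
  case: (@arg_maxP _ _ 'I_N i xpredT (fun p => dot xi (v p s)) isT) => p _ pmax.
  exists p; apply: (solves_on_le st (weight_ge0 x) (follows_velocity xi s0 tT F)) => j.
  exact: pmax.
have diam0 : 0 <= vel_diam v s by exact: bigmax_ge_id.
apply: bigmax_le => // i _; apply: bigmax_le => // j _.
(* Pairing with [D] and [- D] gives particles [p] and [q] such that
   [dot D D <= dot D (v p s - v q s)], the hypothesis of [enorm_le_dot]. *)
pose D := v i t - v j t.
have [p ip] := support D i.
have [q jq] := support (- D) j.
apply: (@le_trans _ _ (enorm (v p s - v q s))).
  apply: enorm_le_dot; rewrite -/D [dot D D]dotBr dotBr lerB//.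
  by move: jq; rewrite !dotNl lerN2.
apply: le_trans (le_bigmax _ _ p).
exact: (le_bigmax _ (fun q => enorm (v p s - v q s)) q).
Qed.

End delayed_system.

Local Close Scope classical_set_scope.
Unset Implicit Arguments.

Theorem theorem1 (R : realType) (N d : nat) (T m delta h : R)
    (M : 'I_N -> nat -> R) (x0 v0 : 'I_N -> 'rV[R]_d)
    (hN : (0 < N)%N) (hd : (0 < d)%N) (hT : 0 < T)
    (hm : 0 < m) (hdelta : 0 < delta) (hh : 0 < h)
    (hM : forall (i : 'I_N) (n : nat), (0 < n <= N)%N -> 0 < M i n) :
  exists x v : 'I_N -> R -> 'rV[R]_d,
    [/\ is_solution T m delta h M x0 v0 x v,
        forall y w : 'I_N -> R -> 'rV[R]_d,
          is_solution T m delta h M x0 v0 y w ->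
          forall (i : 'I_N) (t : R), 0 <= t < T ->
            y i t = x i t /\ w i t = v i t
      & forall s t : R, 0 < s -> s <= t -> t < T ->
          vel_diam v t <= vel_diam v s /\ vel_diam v s <= vel_diam v 0].
Proof.
have [x [v xv]] := solution_exists T m delta x0 v0 hh hM.
exists x, v; split=> // [y w yw|s t s0 st tT]; first exact: solution_unique xv yw.
have s_ge0 := ltW s0.
by split; apply: (vel_diam_le hh hM xv) => //; exact: le_lt_trans tT.
Qed.
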